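(* Let $\varepsilon:\mathfrak{g}^c\hookrightarrow\tilde{\mathfrak{g}}^c$ and $\theta$ be as fixed in the context, with $\varepsilon(\mathfrak{h}^c)\subset\tilde{\mathfrak{h}}^c$ and $\varepsilon(\mathfrak{u})\subset\tilde{\mathfrak{u}}$. Let $\mathrm{ad}:\tilde{\mathfrak{g}}^c\to\mathfrak{gl}(\tilde{\mathfrak{g}}^c)$ be the adjoint representation and set $$\mathcal{A}=\{A\in\mathrm{End}(\tilde{\mathfrak{g}}^c)\mid A\,\mathrm{ad}(\varepsilon\theta(y))=\mathrm{ad}(\varepsilon(y))\,A\ \text{ for all } y\in\mathfrak{g}^c\}.$$ Let $\tilde\theta\in\mathrm{End}(\tilde{\mathfrak{g}}^c)$. Then $\tilde\theta$ is an involution of $\tilde{\mathfrak{g}}^c$ with $\varepsilon\theta=\tilde\theta\varepsilon$ if and only if $\tilde\theta\in\mathcal{A}$ and (1) $\tilde\theta^2=I$, where $I\in\mathrm{End}(\tilde{\mathfrak{g}}^c)$ is the identity; (2) $\tilde\theta\,(\mathrm{ad}\,x)\,\tilde\theta=\mathrm{ad}\,\tilde\theta(x)$ for all $x\in\tilde{\mathfrak{g}}^c$.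
   Context: All Lie algebras are finite-dimensional; $\imath\in\mathbb{C}$ is the imaginary unit; $\mathrm{End}$ denotes $\mathbb{C}$-linear endomorphisms; $\mathrm{ad}\,x(y)=[x,y]$. An embedding is an injective homomorphism of complex Lie algebras. An involution of a complex Lie algebra is a ($\mathbb{C}$-linear) Lie algebra automorphism whose square is the identity (the identity is allowed). A real form of a complex semisimple Lie algebra $\mathfrak{a}^c$ is a real Lie subalgebra $\mathfrak{a}$ with $\mathfrak{a}^c=\mathfrak{a}\oplus\imath\mathfrak{a}$; its conjugation is $x+\imath y\mapsto x-\imath y$ ($x,y\in\mathfrak{a}$). Chevalley basis of a complex semisimple Lie algebra $\mathfrak{a}^c$ with Cartan subalgebra, root system $\Phi$, simple roots $\alpha_1,\dots,\alpha_\ell$: elements $h_1,\dots,h_\ell$ of the Cartan subalgebra and root vectors $x_\alpha$ ($\alpha\in\Phi$) with $[h_i,h_j]=0$, $[h_i,x_\alpha]=\langle\alpha,\alpha_i^\vee\rangle x_\alpha$, $[x_\alpha,x_{-\alpha}]=h_\alpha$, where $h_\alpha$ is the unique element of $[\mathfrak{a}^c_\alpha,\mathfrak{a}^c_{-\alpha}]$ with $[h_\alpha,x_\alpha]=2x_\alpha$ (so $h_{\alpha_i}=h_i$), and $[x_\alpha,x_\beta]=N_{\alpha,\beta}x_{\alpha+\beta}$ for $\alpha+\beta\ne0$, with $N_{\alpha,\beta}=\pm(r+1)$, $r$ the maximal integer with $\alpha-r\beta\in\Phi$ ($x_\gamma=0$ if $\gamma\notin\Phi$). The compact form associated with it is the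 real span of $\imath h_i$ ($1\le i\le\ell$) and $x_\alpha-x_{-\alpha}$, $\imath(x_\alpha+x_{-\alpha})$ ($\alpha\in\Phi^+$). Setting. $\mathfrak{g}^c$, $\tilde{\mathfrak{g}}^c$ are complex semisimple Lie algebras with fixed Cartan subalgebras $\mathfrak{h}^c$, $\tilde{\mathfrak{h}}^c$ and fixed Chevalley bases with respect to them; $\mathfrak{u}$, $\tilde{\mathfrak{u}}$ are the associated compact forms; $\tau$ is the conjugation of $\mathfrak{g}^c$ with respect to $\mathfrak{u}$. $\mathfrak{g}=\mathfrak{k}\oplus\mathfrak{p}$ is a real form of $\mathfrak{g}^c$ with a Cartan decomposition, $\theta$ is the corresponding involution of $\mathfrak{g}^c$ (identity on $\mathfrak{k}$, minus identity on $\mathfrak{p}$, extended $\mathbb{C}$-linearly), and $\sigma$ is the conjugation with respect to $\mathfrak{g}$; it is assumed that $\tau\sigma=\sigma\tau$, $\theta=\tau\sigma$ and $\mathfrak{u}=\mathfrak{k}\oplus\imath\mathfrak{p}$. $\varepsilon:\mathfrak{g}^c\hookrightarrow\tilde{\mathfrak{g}}^c$ is an embedding. *)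

(* Defs.v *)
From HB Require Import structures.
From mathcomp Require Import all_boot all_order all_algebra.
From mathcomp Require Import complex.
From mathcomp Require Import boolp classical_sets reals.

Set Implicit Arguments.
Unset Strict Implicit.
Unset Printing Implicit Defensive.

Import Order.TTheory GRing.Theory Num.Theory.
Local Open Scope classical_set_scope.
Local Open Scope ring_scope.

HB.mixin Record isLieAlgebra (F : fieldType) L & Vector F L := {
  lie : L -> L -> L;
  lie_linearr : forall x, linear (lie x);
  lie_linearl : forall y, linear (fun x => lie x y);
  liexx : forall x, lie x x = 0;
  lie_jacobi : forall x y z,
    lie x (lie y z) + lie y (lie z x) + lie z (lie x y) = 0
}.

#[short(type="lieAlgType")]
HB.structure Definition LieAlgebra (F : fieldType) :=
  { L of isLieAlgebra F L & Vector F L }.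

Notation "⁅ x , y ⁆" := (lie x y)
  (at level 0, x, y at level 99, format "⁅ x ,  y ⁆") : ring_scope.

Section LieAlgebra.
Variables (F : fieldType) (L : lieAlgType F).
Implicit Types (x y z : L) (U V I H : {vspace L}).

HB.instance Definition _ x :=
  GRing.isLinear.Build F L L *:%R (lie x) (lie_linearr x).

Definition ad x : 'End(L) := linfun (lie x).

Lemma adE x y : ad x y = ⁅x, y⁆.
Proof. by rewrite lfunE. Qed.

Lemma ad_is_linear : linear ad.
Proof.
move=> a x y; apply/lfunP => z.
by rewrite add_lfunE scale_lfunE !adE lie_linearl.
Qed.

HB.instance Definition _ :=
  GRing.isLinear.Build F L 'End(L) *:%R ad ad_is_linear.

(* [U, V], the span of all brackets (see [mem_lieprod]). *)
Definition lieprod U V : {vspace L} :=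
  <<[seq ⁅u, v⁆ | u <- vbasis U, v <- vbasis V]>>%VS.

Lemma mem_lieprod U V u v : u \in U -> v \in V -> ⁅u, v⁆ \in lieprod U V.
Proof.
move=> uU vV; rewrite -adE (coord_vbasis uU) linear_sum sum_lfunE.
apply: memv_suml => i _; rewrite linearZ scale_lfunE memvZ //.
rewrite (coord_vbasis vV) linear_sum; apply: memv_suml => j _.
rewrite linearZ memvZ // memv_span //= adE; apply/allpairsP.
by exists ((vbasis U)`_i, (vbasis V)`_j); rewrite !mem_nth ?size_tuple.
Qed.

Definition is_subalgebra H := {in H &, forall x y, ⁅x, y⁆ \in H}.

Definition is_ideal I := forall x y, y \in I -> ⁅x, y⁆ \in I.

Definition solvable I := exists n, iter n (fun U => lieprod U U) I = 0%VS.

Definition nilpotent H := exists n, iter n (lieprod H) H = 0%VS.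

Definition semisimple := forall I, is_ideal I -> solvable I -> I = 0%VS.

Definition is_cartan_subalgebra H :=
  [/\ is_subalgebra H, nilpotent H
    & forall x, {in H, forall y, ⁅x, y⁆ \in H} -> x \in H].

Definition is_lie_automorphism (f : 'End(L)) :=
  bijective f /\ {morph f : x y / ⁅x, y⁆}.

Definition is_involution (f : 'End(L)) :=
  is_lie_automorphism f /\ (f \o f)%VF = \1%VF.

Definition killing x y : F :=
  \tr (passmx.mxof (vbasis {:L}) (vbasis {:L}) (ad x \o ad y)%VF).

Lemma killing_linearr x : linear (killing x : L -> F^o).
Proof.
move=> a y z; rewrite /killing (linearP ad) comp_lfunDr -comp_lfunZr.
by rewrite passmx.mxof_linear mxtraceD mxtraceZ.
Qed.

Lemma killing_linearl y : linear (fun x => killing x y : F^o).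
Proof.
move=> a x z; rewrite /killing (linearP ad) comp_lfunDl -comp_lfunZl.
by rewrite passmx.mxof_linear mxtraceD mxtraceZ.
Qed.

HB.instance Definition _ x :=
  GRing.isLinear.Build F L F^o *:%R (killing x) (killing_linearr x).

Section Roots.
Variable H : {vspace L}.

Definition dual := 'Hom(subvs_of H, F^o).
Implicit Types a b : dual.

Definition root_space a : {vspace L} :=
  let e := vbasis {:subvs_of H} in
  (\bigcap_(i < \dim {:subvs_of H})
     lker (ad (vsval e`_i) - (a e`_i : F) *: (\1%VF : 'End(L)))%R)%VS.

Lemma root_spaceP a x :
  reflect (forall h : subvs_of H, ⁅vsval h, x⁆ = (a h : F) *: x)
    (x \in root_space a).
Proof.
apply: (iffP subv_bigcapP) => [xa h|xa i _]; last first.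
  rewrite -memvE memv_ker add_lfunE opp_lfunE scale_lfunE id_lfunE adE xa.
  by rewrite subrr.
rewrite (coord_vbasis (memvf h)) !linear_sum -adE linear_sum sum_lfunE.
rewrite scaler_suml; apply: eq_bigr => i _; have := xa i isT.
rewrite -memvE memv_ker add_lfunE opp_lfunE scale_lfunE id_lfunE subr_eq0.
by move=> /eqP {}xa; rewrite !linearZ scale_lfunE /= xa scalerA.
Qed.

Definition is_root a := (a != 0) && (root_space a != 0%VS).

Definition killing_functional (h : subvs_of H) : dual :=
  linfun ((killing (vsval h) : L -> F^o) \o vsval).

Lemma killing_functional_linear : linear killing_functional.
Proof.
move=> c h k; apply/lfunP => y.
by rewrite add_lfunE scale_lfunE !lfunE /= killing_linearl.
Qed.

HB.instance Definition _ :=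
  GRing.isLinear.Build F (subvs_of H) dual *:%R killing_functional
    killing_functional_linear.

(* The element t_a of H with killing t_a h = a h for all h in H; it exists and
   is unique when the Killing form is nondegenerate on H. *)
Definition killing_dual a : subvs_of H := ((linfun killing_functional)^-1)%VF a.

Lemma killing_dualP a : lker (linfun killing_functional) = 0%VS ->
  forall h : subvs_of H, killing (vsval (killing_dual a)) (vsval h) = a h.
Proof.
move=> ker0 h.
have [t ->] : exists t, a = linfun killing_functional t.
  have : a \in limg (linfun killing_functional).
    suff -> : limg (linfun killing_functional) = fullv by rewrite memvf.
    apply/eqP; rewrite eqEdim subvf limg_dim_eq ?ker0 ?capv0 //.
    by rewrite !dimvf /dim /= muln1.
  by case/memv_imgP => t _ ->; exists t.
rewrite /killing_dual lker0_lfunK ?ker0 //.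
by rewrite !lfunE.
Qed.

Definition dual_form a b : F :=
  killing (vsval (killing_dual a)) (vsval (killing_dual b)).

(* <a, b^\vee> = 2 (a, b) / (b, b) *)
Definition cartan_int a b : F := 2 * dual_form a b / dual_form b b.

Definition is_root_base l (D : l.-tuple dual) :=
  [/\ forall i, is_root (tnth D i), basis_of {:dual} D
    & forall a, is_root a -> exists n : 'I_l -> nat,
        a = \sum_i tnth D i *+ n i \/ a = - \sum_i tnth D i *+ n i].

Definition is_positive_root l (D : l.-tuple dual) a :=
  is_root a /\ exists n : 'I_l -> nat, a = \sum_i tnth D i *+ n i.

(* The condition determining h_a, for a nonzero vector xa of the root space of
   a, as an element of [L_a, L_(-a)]. *)
Definition is_coroot_vector a xa z :=
  z \in lieprod (root_space a) (root_space (- a)) /\ ⁅z, xa⁆ = 2 *: xa.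

Definition is_string_length a b (r : nat) :=
  is_root (a - b *+ r) /\ forall s, (r < s)%N -> ~~ is_root (a - b *+ s).

Record chevalley_basis := ChevalleyBasis {
  cb_rank : nat;
  cb_simple : cb_rank.-tuple dual;
  cb_h : 'I_cb_rank -> L;
  cb_x : dual -> L;
  cb_simpleP : is_root_base cb_simple;
  cb_hP : forall i, cb_h i \in H;
  cb_xP : forall a, is_root a -> cb_x a \in root_space a /\ cb_x a != 0;
  cb_x_notroot : forall a, ~~ is_root a -> cb_x a = 0;
  cb_hh : forall i j, ⁅cb_h i, cb_h j⁆ = 0;
  cb_hx : forall i a, is_root a ->
    ⁅cb_h i, cb_x a⁆ = cartan_int a (tnth cb_simple i) *: cb_x a;
  cb_xxN : forall a, is_root a ->
    is_coroot_vector a (cb_x a) ⁅cb_x a, cb_x (- a)⁆;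
  cb_xxN_simple : forall i (a := tnth cb_simple i),
    ⁅cb_x a, cb_x (- a)⁆ = cb_h i;
  cb_xx : forall a b, is_root a -> is_root b -> a + b != 0 ->
    exists (r : nat) (s : bool), is_string_length a b r /\
      ⁅cb_x a, cb_x b⁆ = ((-1) ^+ s * r.+1%:R) *: cb_x (a + b)
}.

End Roots.
End LieAlgebra.

Arguments cb_simple {F L H} c.
Arguments cb_h {F L H} c i.
Arguments cb_x {F L H} c a.

Local Open Scope complex_scope.

Section RealForms.
Variables (R : realType) (L : lieAlgType R[i]).
Implicit Types (x y : L) (A B D S : set L).

Definition real_span S : set L :=
  [set x | exists (n : nat) (c : 'I_n -> R) (v : 'I_n -> L),
    (forall i, S (v i)) /\ x = \sum_i (c i)%:C *: v i].

Definition is_real_subspace A :=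
  A 0 /\ forall (c : R) x y, A x -> A y -> A (c%:C *: x + y).

Definition is_real_subalgebra A :=
  is_real_subspace A /\ forall x y, A x -> A y -> A ⁅x, y⁆.

Definition is_direct_sum D A B :=
  D = [set x + y | x in A & y in B] /\ A `&` B = [set 0].

Definition times_i A : set L := [set 'i *: x | x in A].

Definition is_real_form A :=
  is_real_subalgebra A /\ is_direct_sum setT A (times_i A).

(* On a real form A this determines s on all of L. *)
Definition is_conjugation A (s : L -> L) :=
  forall x y, A x -> A y -> s (x + 'i *: y) = x - 'i *: y.

(* The Killing form of a real form of L is the restriction of the Killing form
   of L, as a real basis of the real form is a complex basis of L. *)
Definition is_cartan_decomposition g k p :=
  [/\ is_real_subspace k, is_real_subspace p & is_direct_sum g k p] /\
  [/\ forall x y, k x -> k y -> k ⁅x, y⁆,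
      forall x y, k x -> p y -> p ⁅x, y⁆
    & forall x y, p x -> p y -> k ⁅x, y⁆] /\
  (forall x, k x -> x != 0 -> killing x x < 0) /\
  (forall x, p x -> x != 0 -> 0 < killing x x).

Definition is_cartan_involution k p (theta : 'End(L)) :=
  (forall x, k x -> theta x = x) /\ (forall x, p x -> theta x = - x).

Definition compact_form (H : {vspace L}) (B : chevalley_basis H) : set L :=
  real_span
    ([set 'i *: cb_h B i | i in setT] `|`
     [set cb_x B a - cb_x B (- a) | a in is_positive_root (cb_simple B)] `|`
     [set 'i *: (cb_x B a + cb_x B (- a))
       | a in is_positive_root (cb_simple B)]).

End RealForms.

Definition intertwiners (R : realType) (G G' : lieAlgType R[i])
    (eps : 'Hom(G, G')) (theta : 'End(G)) : set 'End(G') :=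
  [set A | forall y : G,
    (A \o ad (eps (theta y)))%VF = (ad (eps y) \o A)%VF].

(* Main.v *)
Require Import Defs.
From HB Require Import structures.
From mathcomp Require Import all_boot all_order all_algebra.
From mathcomp Require Import complex.
From mathcomp Require Import boolp classical_sets reals.

Set Implicit Arguments.
Unset Strict Implicit.
Unset Printing Implicit Defensive.

Import Order.TTheory GRing.Theory Num.Theory.
Local Open Scope classical_set_scope.
Local Open Scope ring_scope.

(** Once $\tilde\theta^2=I$, condition (2) says exactly that $\tilde\theta$ preserves brackets. For
    such $\tilde\theta$, membership in $\mathcal{A}$ means that $\tilde\theta\varepsilon\theta(y)$
    and $\varepsilon(y)$ have the same adjoint action. Since $\tilde{\mathfrak{g}}^c$ is semisimple,
    its center is zero and [ad] is injective ([semisimple_lker_ad], [semisimple_lie_inj]), so the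
    two elements agree; applying $\tilde\theta$ gives
    $\varepsilon\theta=\tilde\theta\varepsilon$. *)

Lemma semisimple_lker_ad (F : fieldType) (L : lieAlgType F) :
  semisimple L -> lker (linfun (@ad F L)) = 0%VS.
Proof.
have centerP (x : L) : x \in lker (linfun (@ad F L)) ->
    forall y, ⁅x, y⁆ = 0.
  by rewrite memv_ker lfunE /= => /eqP adx0 y; rewrite -adE adx0 zero_lfunE.
(* The kernel of [ad] kills brackets from the left; expanding $[x+y,x+y]=0$ carries this over to the
   right, which makes the kernel an ideal. *)
have lie_center (x y : L) : y \in lker (linfun (@ad F L)) -> ⁅x, y⁆ = 0.
  move=> /centerP y0; have := liexx (x + y).
  rewrite -adE (linearD (@ad F L)) add_lfunE !adE !linearD /=.
  by rewrite !liexx !y0 !addr0 add0r.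
move=> ss; apply: ss; first by move=> x y /(lie_center x) ->; exact: mem0v.
(* The center is abelian, so its derived series vanishes after one step. *)
exists 1%N; apply/eqP; rewrite -subv0 /= /lieprod; apply/span_subvP => w.
move=> /allpairsP[[u v] /= [/vbasis_mem/centerP u0 _ ->]].
by rewrite u0 mem0v.
Qed.

Lemma semisimple_lie_inj (F : fieldType) (L : lieAlgType F) (x y : L) :
  semisimple L -> (forall z, ⁅x, z⁆ = ⁅y, z⁆) -> x = y.
Proof.
move=> /semisimple_lker_ad/eqP/lker0P ad_inj xy; apply: ad_inj.
by rewrite !lfunE; apply/lfunP => z; rewrite !adE.
Qed.

Theorem proposition3p6 (R : realType) (Gc Gt : lieAlgType R[i])
  (Gc_ss : semisimple Gc) (Gt_ss : semisimple Gt)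
  (H : {vspace Gc}) (Ht : {vspace Gt})
  (H_cartan : is_cartan_subalgebra H) (Ht_cartan : is_cartan_subalgebra Ht)
  (B : chevalley_basis H) (Bt : chevalley_basis Ht)
  (g k p : set Gc) (g_real_form : is_real_form g)
  (g_kp : is_cartan_decomposition g k p)
  (theta : 'End(Gc)) (theta_kp : is_cartan_involution k p theta)
  (tau sigma : Gc -> Gc)
  (tau_conj : is_conjugation (compact_form B) tau)
  (sigma_conj : is_conjugation g sigma)
  (tau_sigma : forall x, tau (sigma x) = sigma (tau x))
  (theta_tau_sigma : forall x, theta x = tau (sigma x))
  (u_kp : is_direct_sum (compact_form B) k (times_i p))
  (eps : 'Hom(Gc, Gt)) (eps_inj : injective eps)
  (eps_lie : {morph eps : x y / ⁅x, y⁆})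
  (eps_cartan : (eps @: H <= Ht)%VS)
  (eps_compact : eps @` compact_form B `<=` compact_form Bt)
  (thetat : 'End(Gt)) :
  (is_involution thetat /\ (eps \o theta)%VF = (thetat \o eps)%VF) <->
  [/\ intertwiners eps theta thetat,
      (thetat \o thetat)%VF = \1%VF
    & forall x : Gt, (thetat \o ad x \o thetat)%VF = ad (thetat x)].
Proof.
split=> [[[[_ thetat_lie] thetat2] eps_theta]
        |[thetat_int thetat2 thetat_ad]];
  have thetatK x : thetat (thetat x) = x
    by rewrite -[RHS](id_lfunE x) -thetat2 comp_lfunE.
  have eps_thetaE y : eps (theta y) = thetat (eps y).
    by rewrite -!comp_lfunE eps_theta.
  split=> // [y|x]; apply/lfunP => z.
    by rewrite !comp_lfunE !adE thetat_lie eps_thetaE thetatK.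
  by rewrite !comp_lfunE !adE thetat_lie thetatK.
have thetat_lie : {morph thetat : x y / ⁅x, y⁆}.
  (* Condition (2) is evaluated at $\tilde\theta(y)$, where the inner $\tilde\theta$ cancels. *)
  by move=> x y; rewrite -[RHS]adE -thetat_ad !comp_lfunE adE thetatK.
split; first by split=> //; split=> //; exists thetat.
(* Cancelling one $\tilde\theta$ reduces the goal to
   $\tilde\theta(\varepsilon\theta(y))=\varepsilon(y)$. *)
apply/lfunP => y; rewrite !comp_lfunE -[LHS]thetatK; congr (thetat _).
(* Both sides have the same adjoint action and the center is trivial. *)
apply: (semisimple_lie_inj Gt_ss) => z.
(* At $\tilde\theta(z)$ the intertwining relation reads
   $[\tilde\theta\varepsilon\theta(y),z]=[\varepsilon(y),z]$. *)
have /lfunP/(_ (thetat z)) := thetat_int y.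
by rewrite !comp_lfunE !adE thetat_lie thetatK.
Qed.
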